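(* Let $k\in \mathbb{Z}$ and $n, i,j \in \mathbb{Z}^+$ with $n\geq 2$ and $k\not\equiv 0\pmod n$, and let $K_{i,j}$ be the complete bipartite graph with parts of sizes $i$ and $j$. Then \[ \chi_{(n,k)}(K_{i,j}) = \begin{cases} 2, &\text{if } (i,n) \mid k \text{ and } (j,n) \mid k, \\ 3, &\text{if exactly one of } (i,n) \mid k,\ (j,n) \mid k \text{ holds}, \\ 4, &\text{otherwise.} \end{cases}\]
   Context: $(a,b)$ denotes the greatest common divisor. For a graph $G=(V,E)$, a $\mathbb{Z}$-labeling is a map $\ell:V\to\mathbb{Z}$; its order is the size of its range; it is proper if adjacent vertices get different labels. $N(v)$ is the open neighborhood of $v$. An open coloring with remainder $k \bmod n$ is a labeling with $\sum_{w\in N(v)}\ell(w)\equiv k \pmod n$ for all $v\in V$. $\chi_{(n,k)}(G)$ is the minimum order of a proper open coloring with remainder $k\bmod n$ (when one exists). *)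

(* Defs.v *)
From mathcomp Require Import all_boot all_order all_algebra.

Set Implicit Arguments.
Unset Strict Implicit.
Unset Printing Implicit Defensive.

Import Order.TTheory GRing.Theory Num.Theory.
Local Open Scope ring_scope.

Record sgraph := SGraph {
  vertex :> finType;
  adj : rel vertex;
  adj_sym : symmetric adj;
  adj_irrefl : irreflexive adj }.

Section OpenColorings.
Variable G : sgraph.

Definition open_nbhd (v : G) : {set G} := [set w | adj v w].

Definition labeling_order (l : G -> int) : nat := size (undup (codom l)).

Definition proper (l : G -> int) : Prop :=
  forall v w : G, adj v w -> l v <> l w.

Definition open_coloring (n : nat) (k : int) (l : G -> int) : Prop :=
  forall v : G, (\sum_(w in open_nbhd v) l w = k %[mod n])%Z.

(* "chi_(n,k)(G) exists and equals m", as a relation because a proper open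
   coloring of G with remainder k mod n need not exist. *)
Definition is_chi (n : nat) (k : int) (m : nat) : Prop :=
  (exists l : G -> int,
     [/\ proper l, open_coloring n k l & labeling_order l = m]) /\
  (forall l : G -> int,
     proper l -> open_coloring n k l -> (m <= labeling_order l)%N).

End OpenColorings.

Definition bip_adj (i j : nat) : rel ('I_i + 'I_j)%type := fun u v =>
  match u, v with
  | inl _, inr _ | inr _, inl _ => true
  | _, _ => false
  end.

Lemma bip_adj_sym i j : symmetric (@bip_adj i j).
Proof. by case=> u; case=> v. Qed.

Lemma bip_adj_irrefl i j : irreflexive (@bip_adj i j).
Proof. by case. Qed.

Definition complete_bipartite (i j : nat) : sgraph :=
  SGraph (@bip_adj_sym i j) (@bip_adj_irrefl i j).

(* Main.v *)
(** Adjacent vertices lie in opposite parts, so a proper labeling uses disjoint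
    sets of labels on the two parts, and its order is the sum of the orders of
    the two restrictions.  The coloring condition says that each restriction
    sums to [k] mod [n].  On a part of size [p], a single label [a] works iff
    [p * a] is congruent to [k], i.e. iff [gcd p n] divides [k]; otherwise the
    two labels [k] (once) and [0] (elsewhere) work.  Adding a large multiple of
    [n] to all labels of one part makes the two ranges disjoint. *)
Require Import Defs.
From mathcomp Require Import all_boot all_order all_algebra.

Import Order.TTheory GRing.Theory Num.Theory.
Local Open Scope ring_scope.

Lemma size_undup_codom_sum (A B : finType) (T : eqType) (l : A + B -> T) :
    (forall a b, l (inl a) <> l (inr b)) ->
  size (undup (codom l)) =
    (size (undup (codom (l \o inl))) + size (undup (codom (l \o inr))))%N.
Proof.
move=> ne_l; rewrite -size_cat; apply/eqP; rewrite -uniq_size_uniq.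
- exact: undup_uniq.
- rewrite cat_uniq !undup_uniq andbT /=; apply/hasPn => x.
  rewrite !mem_undup => /codomP[b ->]; apply/negP => /codomP[a] /esym.
  exact: ne_l.
move=> x; rewrite mem_cat !mem_undup; apply/orP/codomP.
- by case=> /codomP[y ->]; [exists (inl y) | exists (inr y)].
- by case=> [[y|y] ->]; [left | right]; apply/codomP; exists y.
Qed.

Lemma size_undup_codom_comp_inj (A : finType) (T U : eqType) (f : A -> T)
    (h : T -> U) :
  injective h -> size (undup (codom (h \o f))) = size (undup (codom f)).
Proof. by move=> inj_h; rewrite /codom /image_mem map_comp undup_map_inj // size_map. Qed.

Lemma gcdz_dvd_modP (p n : nat) (k : int) :
  reflect (exists a : int, (a * p%:Z = k %[mod n])%Z) (gcdz p n %| k)%Z.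
Proof.
apply: (iffP idP) => [/dvdzP[q ->]|[a /eqP]].
- have [u [v <-]] := Bezoutz p n; exists (q * u).
  by rewrite mulrDr !mulrA addrC modzMDl.
- rewrite eqz_mod_dvd => dvd_n; rewrite -[k](subKr (a * p%:Z)) rpredB //.
    exact: dvdz_mull (dvdz_gcdl _ _).
  exact: dvdz_trans (dvdz_gcdr _ _) dvd_n.
Qed.

Definition part_order (p n : nat) (k : int) : nat :=
  if (gcdz p n %| k)%Z then 1%N else 2%N.

Lemma part_order_exists (p n : nat) (k : int) :
    (0 < p)%N -> (k != 0 %[mod n])%Z ->
  exists f : 'I_p -> int, (\sum_x f x = k %[mod n])%Z /\
    size (undup (codom f)) = part_order p n k.
Proof.
case: p => [//|p] _ hk; rewrite /part_order.
case: gcdz_dvd_modP => [[a ha]|nodvd].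
- exists (fun=> a); split; first by rewrite sumr_const card_ord -mulr_natr natz.
  rewrite -[RHS]/(size [:: a]); apply/eqP; rewrite -uniq_size_uniq ?undup_uniq //.
  move=> x; rewrite mem_undup inE; apply/eqP/codomP => [->|[] //].
  by exists ord0.
- have k_neq0 : k != 0 by apply: contraNneq hk => ->.
  exists (fun x => if x == ord0 then k else 0); split.
    by rewrite -big_mkcond big_pred1_eq.
  have p_gt0 : (0 < p)%N.
    case: p nodvd => // nodvd; case: nodvd; exists k; by rewrite mulr1.
  rewrite -[RHS]/(size [:: k; 0]); apply/eqP; rewrite -uniq_size_uniq ?undup_uniq //.
    by rewrite /= inE k_neq0.
  move=> x; rewrite mem_undup !inE; apply/orP/codomP => [|[y ->]].
    case=> /eqP ->; first by exists ord0.
    by exists ord_max; rewrite -val_eqE /= eqn0Ngt p_gt0.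
  by case: ifP; [left | right].
Qed.

Lemma part_order_le (p n : nat) (k : int) (f : 'I_p -> int) :
    (0 < p)%N -> (\sum_x f x = k %[mod n])%Z ->
  (part_order p n k <= size (undup (codom f)))%N.
Proof.
move=> p_gt0 sum_f; pose x0 := Ordinal p_gt0.
have fP x : f x \in undup (codom f) by rewrite mem_undup codom_f.
rewrite /part_order; case: gcdz_dvd_modP => [_|nodvd].
  by case: (undup _) (fP x0).
case def_s: (undup (codom f)) fP => [|a [|b s]] fP //.
  by have := fP x0.
case: nodvd; exists a; rewrite -sum_f.
rewrite (eq_bigr (fun=> a)) => [|x _]; last by apply/eqP; rewrite -mem_seq1.
by rewrite sumr_const card_ord -mulr_natr natz.
Qed.

Lemma shift_avoids (A B : finType) (n : nat) (f : A -> int) (g : B -> int) :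
  (0 < n)%N -> exists t : int, forall a b, f a <> g b + t * n%:Z.
Proof.
move=> n_gt0; pose M : int := \sum_a `|f a| + \sum_b `|g b|.
have M_ge0 : 0 <= M by rewrite addr_ge0 ?sumr_ge0.
exists (M + 1) => a b fE; have : M + 1 <= f a - g b.
  by rewrite fE [leRHS]addrAC subrr add0r ler_peMr ?(addr_ge0 M_ge0).
apply/negP; rewrite -ltNge ltzD1; apply: le_trans (ler_norm _) _.
apply: le_trans (ler_normB _ _) _.
by apply: lerD; [rewrite (bigD1 a) | rewrite (bigD1 b)]; rewrite //= lerDl sumr_ge0.
Qed.

Lemma sum_shift_mod (p n : nat) (g : 'I_p -> int) (t : int) :
  (\sum_x (g x + t * n%:Z) = \sum_x g x %[mod n])%Z.
Proof.
by rewrite big_split /= sumr_const card_ord -mulrnAl addrC modzMDl.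
Qed.

Section CompleteBipartite.
Variables (i j : nat) (l : complete_bipartite i j -> int).

Lemma sum_open_nbhd_inl (x : 'I_i) :
  \sum_(w in open_nbhd (inl x : complete_bipartite i j)) l w
    = \sum_y l (inr y).
Proof.
rewrite big_sumType /= big1 ?add0r => [|y]; last by rewrite inE.
by apply: eq_bigl => y; rewrite inE.
Qed.

Lemma sum_open_nbhd_inr (y : 'I_j) :
  \sum_(w in open_nbhd (inr y : complete_bipartite i j)) l w
    = \sum_x l (inl x).
Proof.
rewrite big_sumType /= [X in _ + X]big1 ?addr0 => [|x]; last by rewrite inE.
by apply: eq_bigl => x; rewrite inE.
Qed.

Lemma open_coloring_bipartiteP (n : nat) (k : int) :
    (0 < i)%N -> (0 < j)%N ->
  open_coloring n k l <->
    (\sum_x l (inl x) = k %[mod n])%Z /\ (\sum_y l (inr y) = k %[mod n])%Z.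
Proof.
move=> hi hj; split=> [col|[suml sumr] [x|y]].
- split; first by rewrite -(sum_open_nbhd_inr (Ordinal hj)).
  by rewrite -(sum_open_nbhd_inl (Ordinal hi)).
- by rewrite sum_open_nbhd_inl.
- by rewrite sum_open_nbhd_inr.
Qed.

Lemma proper_bipartiteP : Defs.proper l <-> forall x y, l (inl x) <> l (inr y).
Proof.
split=> [prop_l x y|ne_l]; first exact: prop_l.
by case=> [x|y] [x'|y'] //= _; apply: nesym.
Qed.

Lemma labeling_order_bipartite :
    Defs.proper l ->
  labeling_order l =
    (size (undup (codom (fun x => l (inl x)))) +
     size (undup (codom (fun y => l (inr y)))))%N.
Proof. by move/proper_bipartiteP => /size_undup_codom_sum. Qed.

End CompleteBipartite.

Theorem theorem6p5 (k : int) (n i j : nat)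
    (hn : (2 <= n)%N) (hi : (0 < i)%N) (hj : (0 < j)%N)
    (hk : (k != 0 %[mod n])%Z) :
  is_chi (complete_bipartite i j) n k
    (if (gcdz i n %| k)%Z && (gcdz j n %| k)%Z then 2
     else if (gcdz i n %| k)%Z (+) (gcdz j n %| k)%Z then 3
     else 4)%N.
Proof.
set m := (X in is_chi _ _ _ X).
have -> : m = (part_order i n k + part_order j n k)%N.
  by rewrite /m /part_order; do 2!case: (_ %| _)%Z.
split=> [|l prop_l /open_coloring_bipartiteP[] // sum_l sum_r]; last first.
  by rewrite labeling_order_bipartite // leq_add ?part_order_le.
have [f [sum_f ord_f]] := part_order_exists i n k hi hk.
have [g [sum_g ord_g]] := part_order_exists j n k hj hk.
have [t ne_t] := shift_avoids _ _ n f g (ltnW hn).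
pose l (v : complete_bipartite i j) : int :=
  match v with inl x => f x | inr y => g y + t * n%:Z end.
have prop_l : Defs.proper l by apply/proper_bipartiteP.
exists l; split=> //.
- by apply/open_coloring_bipartiteP; rewrite //= sum_shift_mod.
- rewrite labeling_order_bipartite //= ord_f -ord_g.
  by rewrite -(size_undup_codom_comp_inj _ _ _ g _ (addIr (t * n%:Z))).
Qed.
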